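(* Let $\mathfrak{G}$ be a finite group with at least $2$ elements and let $d\in\mathbb{N}$, $d\ge 1$. For each $n\in\mathbb{N}$ let $G_n=(V_n,E_n)$ be a finite connected simple directed graph such that $\deg(v)\le d$ for all $v\in V_n$, let $\pi_n$ be the uniform distribution on $\mathfrak{G}$, and let $Q_n$ be the uniform observation kernel on $G_n$ with flip probability $p_n$. Suppose that (i) for each $n$ there exists an independent set $D_n\subset V_n$ such that $|D_n|\to\infty$ as $n\to\infty$; (ii) $p_n\in(0,1/2)$ for all $n$; and (iii) $p_n=\omega\bigl(|D_n|^{-1/d}\bigr)$. Then the sequence of synchronization problems $\{(G_n,\mathfrak{G},Q_n,\pi_n)\}_{n=1}^{\infty}$ does not have the strong recovery property.
   Context: For a directed graph $G=(V,E)$ with $E\subset V\times V$, $\deg(v)$ is the number of edges incident to $v$ (in either direction). A set $D\subset V$ is independent if for each pair $u,v\in D$ there is no edge $(u,v)\in E$. Connectedness refers to the underlying undirected graph. For non-negative sequences $\{a_n\},\{b_n\}$, $b_n=\omega(a_n)$ means: for every real $c>0$ there exists $N\in\mathbb{N}$ such that $b_n>c\,a_n\ge 0$ for all $n\ge N$. For a finite group $\mathfrak{G}$, define $\psi:\mathfrak{G}^V\to\mathfrak{G}^E$ by $\psi(x)(u,v)=x(u)^{-1}x(v)$ for $(u,v)\in E$ (written $\psi_n$ for the $n$-th graph of a sequence). An observation kernel $Q$ assigns to each $x\in\mathfrak{G}^V$ a probability distribution $Q(\cdot\mid\psi(x))$ on $\mathfrak{G}^E$. The uniform observation kernel with flip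 probability $p$ is $$Q(y\mid\psi(x))=\prod_{(u,v)\in E}Q'(y(u,v)\mid\psi(x)(u,v)),$$ where $Q'(y(u,v)\mid\psi(x)(u,v))=1-p$ if $y(u,v)=x(u)^{-1}x(v)$, and $=\frac{p}{|\mathfrak{G}|-1}$ otherwise. A synchronization problem is a tuple $(G,\mathfrak{G},Q,\pi)$, where $G=(V,E)$ is a graph, $\mathfrak{G}$ a finite group, $Q$ an observation kernel and $\pi$ a probability distribution on $\mathfrak{G}$ (the prior). An estimator is a function $T:\mathfrak{G}^E\to\mathfrak{G}^E$. Given a sequence of synchronization problems $\{(G_n,\mathfrak{G},Q_n,\pi_n)\}$ with $G_n=(V_n,E_n)$, for each $n$ draw $X_n\in\mathfrak{G}^{V_n}$ from the product distribution $\pi_n^{V_n}$, then draw $Y_n\in\mathfrak{G}^{E_n}$ from $Q_n(\cdot\mid\psi_n(X_n))$, and set $\theta_n=\psi_n(X_n)$. A sequence of estimators $T_n:\mathfrak{G}^{E_n}\to\mathfrak{G}^{E_n}$ has the strong recovery property if $\lim_{n\to\infty}\mathbb{P}(T_n(Y_n)=\theta_n)=1$. The sequence of synchronization problems has the strong recovery property if there exists a sequence of estimators having the strong recovery property. *)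

(* Defs.v *)
From HB Require Import structures.
From mathcomp Require Import all_boot all_order all_algebra fingroup.
From mathcomp Require Import all_classical all_reals all_analysis.
Set Implicit Arguments.
Unset Strict Implicit.
Unset Printing Implicit Defensive.
Import Order.TTheory GRing.Theory Num.Theory.
Import numFieldNormedType.Exports.
Local Open Scope ring_scope.

Record digraph := Digraph {
  vertex : finType;
  arcs : {set vertex * vertex}
}.

(* The index type of families in 𝔊^E. *)
Definition arc (G : digraph) : finType := {e : vertex G * vertex G | e \in arcs G}.

(* Since [arcs] is a set, parallel arcs are excluded by construction; only
   loops remain to be ruled out. Antiparallel pairs (u,v), (v,u) are allowed. *)
Definition simple_digraph (G : digraph) : Prop :=
  forall v : vertex G, (v, v) \notin arcs G.

Definition degree (G : digraph) (v : vertex G) : nat :=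
  #|[set e in arcs G | (e.1 == v) || (e.2 == v)]|.

Definition adjacent (G : digraph) : rel (vertex G) :=
  fun u v => ((u, v) \in arcs G) || ((v, u) \in arcs G).

Definition connected_digraph (G : digraph) : Prop :=
  forall u v : vertex G, connect (@adjacent G) u v.

Definition independent (G : digraph) (D : {set vertex G}) : Prop :=
  forall u v, u \in D -> v \in D -> (u, v) \notin arcs G.

(* [little_omega b a] is b_n = ω(a_n). *)
Definition little_omega (R : realType) (b a : nat -> R) : Prop :=
  forall c : R, 0 < c ->
    exists N : nat, forall n, (N <= n)%N -> 0 <= c * a n < b n.

Record fdist (R : realType) (T : finType) := FDist {
  pmf :> T -> R;
  pmf_ge0 : forall t, 0 <= pmf t;
  pmf_sum1 : \sum_t pmf t = 1
}.

Definition Pr (R : realType) (T : finType) (mu : fdist R T) (A : {set T}) : R :=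
  \sum_(t in A) mu t.

Section Constructions.
Variable R : realType.

Section Uniform.
Variable gT : finGroupType.

Let unif (_ : gT) : R := #|gT|%:R^-1.

Let unif_ge0 t : 0 <= unif t.
Proof. by rewrite invr_ge0. Qed.

Let unif_sum1 : \sum_t unif t = 1.
Proof.
rewrite sumr_const -[X in X *+ _]mul1r -mulrnAr -mulr_natr mul1r mulVf //.
by rewrite pnatr_eq0 -lt0n; apply/card_gt0P; exists 1%g.
Qed.

Definition uniform_dist : fdist R gT := FDist unif_ge0 unif_sum1.
End Uniform.

Section Product.
Variables (I T : finType) (mu : I -> fdist R T).

Let prod_pmf (f : {ffun I -> T}) : R := \prod_i mu i (f i).

Let prod_ge0 f : 0 <= prod_pmf f.
Proof. by apply: prodr_ge0 => i _; exact: pmf_ge0. Qed.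

Let prod_sum1 : \sum_f prod_pmf f = 1.
Proof.
rewrite /prod_pmf -(bigA_distr_bigA (fun i t => mu i t)).
by rewrite big1 // => i _; exact: pmf_sum1.
Qed.

Definition product_dist : fdist R {ffun I -> T} := FDist prod_ge0 prod_sum1.
End Product.

Section Joint.
Variables (A B : finType) (mu : fdist R A) (K : A -> fdist R B).

Let joint_pmf (ab : A * B) : R := mu ab.1 * K ab.1 ab.2.

Let joint_ge0 ab : 0 <= joint_pmf ab.
Proof. by apply: mulr_ge0; exact: pmf_ge0. Qed.

Let joint_sum1 : \sum_ab joint_pmf ab = 1.
Proof.
rewrite -(pair_big predT predT (fun a b => mu a * K a b)) /=.
rewrite -[RHS](pmf_sum1 mu); apply: eq_bigr => a _.
by rewrite -mulr_sumr pmf_sum1 mulr1.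
Qed.

(* The law of (X, Y), where X has law mu and Y has law K x given X = x. *)
Definition joint_dist : fdist R (A * B)%type := FDist joint_ge0 joint_sum1.
End Joint.

End Constructions.

Definition psi (gT : finGroupType) (G : digraph) (x : {ffun vertex G -> gT}) :
    {ffun arc G -> gT} :=
  [ffun e : arc G => ((x (val e).1)^-1 * x (val e).2)%g].

(* [Q theta] is Q(. | theta). Only its values at theta = psi x are ever used. *)
Definition observation_kernel (R : realType) (gT : finGroupType) (G : digraph) :=
  {ffun arc G -> gT} -> fdist R {ffun arc G -> gT}.

(* Q'(h | g). *)
Definition flip_prob (R : realType) (gT : finGroupType) (p : R) (h g : gT) : R :=
  if h == g then 1 - p else p / (#|gT|.-1)%:R.

Definition is_uniform_kernel (R : realType) (gT : finGroupType) (G : digraph)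
    (p : R) (Q : observation_kernel R gT G) : Prop :=
  forall (x : {ffun vertex G -> gT}) (y : {ffun arc G -> gT}),
    Q (psi x) y = \prod_(e : arc G) flip_prob p (y e) (psi x e).

Lemma uniform_kernel_exists (R : realType) (gT : finGroupType) (G : digraph)
    (p : R) : (1 < #|gT|)%N -> 0 <= p <= 1 ->
  exists Q : observation_kernel R gT G, is_uniform_kernel p Q.
Proof.
move=> hG /andP[p0 p1].
have q_ge0 (g h : gT) : 0 <= flip_prob p h g.
  by rewrite /flip_prob; case: ifP => _; rewrite ?subr_ge0 // divr_ge0.
have q_sum1 (g : gT) : \sum_h flip_prob p h g = 1.
  rewrite (bigD1 g) //= /flip_prob eqxx.
  rewrite (eq_bigr (fun=> p / (#|gT|.-1)%:R)); last by move=> h /negbTE ->.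
  rewrite sumr_const cardC1 -[X in _ + X]mulr_natr divfK ?subrK //.
  by rewrite pnatr_eq0 -lt0n -ltnS prednK // ltnW.
pose q g := FDist (q_ge0 g) (q_sum1 g).
by exists (fun theta => product_dist (fun e => q (theta e))).
Qed.

Record sync_problem (R : realType) (gT : finGroupType) := SyncProblem {
  graph : digraph;
  kernel : observation_kernel R gT graph;
  prior : fdist R gT
}.
Arguments kernel {R gT} s theta : rename.

Definition estimator (R : realType) (gT : finGroupType)
    (S : sync_problem R gT) : Type :=
  {ffun arc (graph S) -> gT} -> {ffun arc (graph S) -> gT}.

Definition sync_law (R : realType) (gT : finGroupType) (S : sync_problem R gT) :
    fdist R ({ffun vertex (graph S) -> gT} * {ffun arc (graph S) -> gT})%type :=
  joint_dist (product_dist (fun _ : vertex (graph S) => prior S))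
             (fun x => kernel S (psi x)).

(* P(T(Y) = theta), where theta = psi(X). *)
Definition recovery_prob (R : realType) (gT : finGroupType)
    (S : sync_problem R gT) (T : estimator S) : R :=
  Pr (sync_law S) [set xy | T xy.2 == psi xy.1].

Definition estimators_strong_recovery (R : realType) (gT : finGroupType)
    (S : nat -> sync_problem R gT) (T : forall n, estimator (S n)) : Prop :=
  ((fun n => recovery_prob (T n)) @ \oo --> (1 : R))%classic.

Definition strong_recovery (R : realType) (gT : finGroupType)
    (S : nat -> sync_problem R gT) : Prop :=
  exists T : forall n, estimator (S n), estimators_strong_recovery T.

(* Main.v *)
(** Fix [h != 1].  Call [v] in [D] flipped when every arc at [v] is observed as
    if [x v] were [x v * h].  Replacing [x v] by [x v * h] at a flipped vertex
    does not decrease the likelihood, since [p / (#|gT| - 1) <= 1 - p], and it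
    changes [psi x].  As the vertex can be chosen from [y] and [T y] alone, this
    injects the successes having a flipped vertex into the failures, so
    [P(success) <= P(failure) + P(no flipped vertex)].  The stars of the vertices
    of [D] are disjoint, so the last term is at most
    [(1 - (p / (#|gT| - 1)) ^ d) ^ #|D|], which is eventually at most [1/3];
    hence [P(success) <= 2/3]. *)
Require Import Defs.
From HB Require Import structures.
From mathcomp Require Import all_boot all_order all_algebra fingroup.
From mathcomp Require Import all_classical all_reals all_analysis.
From mathcomp Require Import lra.
Import Order.TTheory GRing.Theory Num.Theory.
Import numFieldNormedType.Exports.
Set Implicit Arguments.
Unset Strict Implicit.
Local Open Scope ring_scope.

(** * Events on disjoint blocks of coordinates under a product law *)

Section ProductLaw.
Variables (R : realType) (I T : finType) (f : I -> T -> R) (t : I -> T).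
Hypothesis f_sum1 : forall i, \sum_a f i a = 1.

(** The indicator is itself a product over coordinates, so it is absorbed into the factors and the
    sum of products becomes a product of sums. Coordinates outside [J] contribute 1. *)
Lemma sum_prod_fixed (J : {set I}) :
  \sum_(y : {ffun I -> T})
     (\prod_i f i (y i)) * [forall i in J, y i == t i]%:R
  = \prod_(i in J) f i (t i).
Proof.
pose g i a := f i a * ((i \in J) ==> (a == t i))%:R.
transitivity (\sum_(y : {ffun I -> T}) \prod_i g i (y i)).
  apply: eq_bigr => y _; rewrite big_split /=; congr (_ * _).
  case: (boolP [forall i in J, y i == t i]) => [/forallP yJ|].
    by rewrite big1 // => i _; rewrite yJ.
  by case/forallPn => i /negbTE yi; rewrite (bigD1 i) //= yi mul0r.
rewrite -(bigA_distr_bigA g) [RHS]big_mkcond /=; apply: eq_bigr => i _.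
rewrite /g; case: (i \in J) => /=; last first.
  by under eq_bigr do rewrite mulr1.
rewrite (bigD1 (t i)) //= eqxx mulr1 big1 ?addr0 // => a /negbTE ->.
by rewrite mulr0.
Qed.

(** Events that depend on disjoint blocks of coordinates are independent, and so are their
    complements. *)
Lemma sum_prod_avoid (V : eqType) (B : V -> {set I}) (s : seq V) :
    uniq s -> {in s &, forall u v, u != v -> [disjoint B u & B v]} ->
  \sum_(y : {ffun I -> T}) (\prod_i f i (y i)) *
     \prod_(v <- s) (1 - [forall i in B v, y i == t i]%:R)
  = \prod_(v <- s) (1 - \prod_(i in B v) f i (t i)).
Proof.
(* The induction needs the event on which [y] is prescribed on a further set [J]. *)
suff gen (J : {set I}) : uniq s ->
    {in s &, forall u v, u != v -> [disjoint B u & B v]} ->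
    {in s, forall v, [disjoint J & B v]} ->
    \sum_(y : {ffun I -> T}) (\prod_i f i (y i)) *
       ([forall i in J, y i == t i]%:R *
        \prod_(v <- s) (1 - [forall i in B v, y i == t i]%:R))
    = (\prod_(i in J) f i (t i)) *
      \prod_(v <- s) (1 - \prod_(i in B v) f i (t i)).
  move=> us dB; have := gen finset.set0 us dB; rewrite big_set0 mul1r => <-.
    apply: eq_bigr => y _; congr (_ * _).
    have -> : [forall i in finset.set0, y i == t i].
      by apply/forallP => i; rewrite inE.
    by rewrite mul1r.
  by move=> v _; rewrite -setI_eq0 finset.set0I.
elim: s J => [|a s IHs] J /=.
  move=> _ _ _; rewrite big_nil mulr1 -sum_prod_fixed.
  by apply: eq_bigr => y _; rewrite big_nil mulr1.
case/andP=> as_ us dB dJ.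
have dBs : {in s &, forall u v, u != v -> [disjoint B u & B v]}.
  by move=> u v us_ vs; apply: dB; rewrite inE ?us_ ?vs orbT.
have dJs : {in s, forall v, [disjoint J & B v]}.
  by move=> v vs; apply: dJ; rewrite inE vs orbT.
have dJa : [disjoint J & B a] by apply: dJ; rewrite inE eqxx.
have dJBs : {in s, forall v, [disjoint J :|: B a & B v]}.
  move=> v vs; rewrite -setI_eq0 finset.setIUl finset.setU_eq0 !setI_eq0 dJs //=.
  by apply: dB; rewrite ?inE ?eqxx ?vs ?orbT //; apply: contraNneq as_ => ->.
(* Expanding the factor [1 - ...] of [a] writes each side as its version for [J] minus its version
   for [J :|: B a]. The induction hypothesis applies to both. *)
rewrite big_cons mulrA mulrBr mulr1 mulrBl -bigU //=.
rewrite -(eq_bigl _ _ (fun i => finset.in_setU i J (B a))) -!IHs // -sumrB.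
apply: eq_bigr => y _; rewrite big_cons -mulrBr; congr (_ * _).
rewrite mulrA mulrBr mulr1 mulrBl; congr (_ - _ * _).
rewrite -natrM mulnb; congr (_ %:R); congr nat_of_bool.
apply/andP/forallP => [[/forallP yJ /forallP ya] i|yU].
  by apply/implyP; rewrite inE => /orP[]; [have := yJ i|have := ya i];
    move/implyP; apply.
by split; apply/forallP => i; apply/implyP => iJ; have := yU i;
  rewrite inE iJ ?orbT.
Qed.

End ProductLaw.

(** * Stars, and the effect on [psi x] of changing one label *)

Definition star (G : digraph) (v : vertex G) : {set Defs.arc G} :=
  [set e : Defs.arc G | ((val e).1 == v) || ((val e).2 == v)]%SET.

Lemma card_star (G : digraph) (v : vertex G) : #|star v| = degree v.
Proof.
rewrite -(card_imset _ val_inj); apply: eq_card => e; rewrite !inE.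
apply/imsetP/andP => [[a]|[eG ev]]; first by rewrite inE => av ->; rewrite (valP a).
by exists (exist _ e eG : Defs.arc G); rewrite ?inE.
Qed.

(** The first step of a path from [v] to [u] is an arc at [v]. This guarantees that a twist at [v]
    is visible in [psi x]. *)
Lemma star_neq0 (G : digraph) (u v : vertex G) :
  connected_digraph G -> u != v -> exists e, e \in star v.
Proof.
move=> Gc uv; have /connectP[[|w s] /=] := Gc v u.
  by move=> _ uE; rewrite uE eqxx in uv.
case/andP=> /orP[] vw _ _.
  by exists (exist _ (v, w) vw : Defs.arc G); rewrite inE /= eqxx.
by exists (exist _ (w, v) vw : Defs.arc G); rewrite inE /= eqxx orbT.
Qed.

Lemma disjoint_stars (G : digraph) (D : {set vertex G}) : independent D ->
  {in D &, forall u v, u != v -> [disjoint star u & star v]}.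
Proof.
move=> Di u v uD vD uv; rewrite -setI_eq0; apply/eqP/setP => -[[a b] /= ab].
rewrite !inE /=; apply/negP => /andP[/orP[]/eqP E1 /orP[]/eqP E2]; subst.
- by rewrite eqxx in uv.
- by have := Di _ _ uD vD; rewrite ab.
- by have := Di _ _ vD uD; rewrite ab.
- by rewrite eqxx in uv.
Qed.

Definition twist (gT : finGroupType) (V : finType) (h : gT) (v : V)
    (x : {ffun V -> gT}) : {ffun V -> gT} :=
  [ffun u => if u == v then (x u * h)%g else x u].

Lemma twist_inj (gT : finGroupType) (V : finType) (h : gT) (v : V) :
  injective (@twist gT V h v).
Proof.
move=> x y /ffunP xy; apply/ffunP => u; have := xy u; rewrite !ffunE.
by case: ifP => // _ /mulIg.
Qed.

(* For independent [D], an arc meets [D] in at most one end, so this is the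
   effect on [theta = psi x] of multiplying [x] by [h] at all vertices of [D]. *)
Definition shift (gT : finGroupType) (G : digraph) (D : {set vertex G}) (h : gT)
    (theta : {ffun Defs.arc G -> gT}) (e : Defs.arc G) : gT :=
  if (val e).1 \in D then (h^-1 * theta e)%g
  else if (val e).2 \in D then (theta e * h)%g else theta e.

(** An arc at [v] has its other end outside [D], so there [shift D] acts as a change at [v] alone.
    Independence, applied to the pair [v], [v], also excludes a loop. *)
Lemma psi_twist (gT : finGroupType) (G : digraph) (D : {set vertex G}) (h : gT)
    (v : vertex G) (x : {ffun vertex G -> gT}) (e : Defs.arc G) :
    independent D -> v \in D ->
  psi (twist h v x) e = if e \in star v then shift D h (psi x) e else psi x e.
Proof.
move=> Di vD; rewrite /shift !ffunE inE; case: e => -[a b] /= ab.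
have [av|av] /= := eqVneq a v; have [bv|bv] /= := eqVneq b v; subst => //.
- by have := Di _ _ vD vD; rewrite ab.
- by rewrite vD invMg mulgA.
- case: ifP => aD; first by have := Di _ _ aD vD; rewrite ab.
  by rewrite vD mulgA.
Qed.

Lemma shift_neq (gT : finGroupType) (G : digraph) (D : {set vertex G}) (h : gT)
    (theta : {ffun Defs.arc G -> gT}) (v : vertex G) (e : Defs.arc G) :
  h != 1%g -> v \in D -> e \in star v -> shift D h theta e != theta e.
Proof.
move=> h1 vD; rewrite inE /shift => /orP ev.
case: ifP => [_|/negbT aD]; first by rewrite eq_mulgV1 mulgK eq_invg1.
case: ifP => [_|/negbT bD].
  by rewrite -[X in _ != X]mulg1 (inj_eq (mulgI _)).
by case: ev => /eqP E; [move: aD|move: bD]; rewrite E vD.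
Qed.

Definition flipped (gT : finGroupType) (G : digraph) (D : {set vertex G}) (h : gT)
    (theta y : {ffun Defs.arc G -> gT}) (v : vertex G) : bool :=
  [forall e in star v, y e == shift D h theta e].

(** * Likelihood of flipped vertices *)

Section FlipProb.
Variables (R : realType) (gT : finGroupType) (p : R).
Hypotheses (card_gT : (2 <= #|gT|)%N) (p_range : 0 < p < 1 / 2).

Lemma flip_prob_sum1 (g : gT) : \sum_a flip_prob p a g = 1.
Proof.
rewrite (bigD1 g) //= /flip_prob eqxx.
rewrite (eq_bigr (fun=> p / (#|gT|.-1)%:R)); last by move=> a /negbTE ->.
rewrite sumr_const cardC1 -[X in _ + X]mulr_natr divfK ?subrK //.
by rewrite pnatr_eq0 -lt0n -ltnS prednK // ltnW.
Qed.

Lemma flip_rate_range : 0 < p / (#|gT|.-1)%:R <= 1 - p.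
Proof.
have /andP[p0 p2] := p_range.
have k1 : (1 : R) <= (#|gT|.-1)%:R by rewrite ler1n -ltnS prednK // ltnW.
have k0 : (0 : R) < (#|gT|.-1)%:R by apply: lt_le_trans k1.
rewrite divr_gt0 //= ler_pdivrMr //.
have : (1 - p) * 1 <= (1 - p) * (#|gT|.-1)%:R by rewrite ler_wpM2l //; lra.
by move: p2; lra.
Qed.

Lemma flip_prob_ge0 (a g : gT) : 0 <= flip_prob p a g.
Proof.
have /andP[q0 qp] := flip_rate_range; rewrite /flip_prob.
by case: ifP => _; [apply: le_trans qp|]; exact: ltW.
Qed.

(** On the star of [v] the observation agrees with the twisted labels, so each factor rises from
    [p / (#|gT| - 1)] to [1 - p]. The other factors are unchanged. *)
Lemma likelihood_twist (G : digraph) (D : {set vertex G}) (h : gT)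
    (v : vertex G) (x : {ffun vertex G -> gT}) (y : {ffun Defs.arc G -> gT}) :
    independent D -> h != 1%g -> v \in D -> flipped D h (psi x) y v ->
  \prod_e flip_prob p (y e) (psi x e)
  <= \prod_e flip_prob p (y e) (psi (twist h v x) e).
Proof.
move=> Di h1 vD /forallP yv; apply: ler_prod => e _.
rewrite flip_prob_ge0 (psi_twist _ _ _ Di) //=.
case: ifP => [ev|_]; last exact: lexx.
have /implyP/(_ ev)/eqP -> := yv e.
rewrite /flip_prob eqxx (negbTE (shift_neq _ h1 vD ev)).
by case/andP: flip_rate_range.
Qed.

Lemma no_flip_le (G : digraph) (D : {set vertex G}) (h : gT) (d : nat)
    (theta : {ffun Defs.arc G -> gT}) :
    independent D -> h != 1%g -> (forall v : vertex G, (degree v <= d)%N) ->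
  \sum_(y : {ffun Defs.arc G -> gT} | ~~ [exists v in D, flipped D h theta y v])
     \prod_e flip_prob p (y e) (theta e)
  <= (1 - (p / (#|gT|.-1)%:R) ^+ d) ^+ #|D|.
Proof.
move=> Di h1 degd; have /andP[q0 qp] := flip_rate_range.
have q1 : p / (#|gT|.-1)%:R <= 1 by apply: le_trans qp _; case/andP: p_range; lra.
have -> : \sum_(y : {ffun Defs.arc G -> gT}
                  | ~~ [exists v in D, flipped D h theta y v])
     \prod_e flip_prob p (y e) (theta e) =
   \sum_(y : {ffun Defs.arc G -> gT}) (\prod_e flip_prob p (y e) (theta e)) *
     \prod_(v <- enum D)
       (1 - [forall e in star v, y e == shift D h theta e]%:R).
  rewrite big_mkcond /=; apply: eq_bigr => y _.
  case: (boolP [exists v in D, _]) => [/existsP[v /andP[vD yv]]|/existsPn nv] /=.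
    have vE : v \in enum D by rewrite mem_enum.
    rewrite [X in _ * X](bigD1_seq v) ?enum_uniq //=.
    by move: yv; rewrite /flipped => ->; rewrite subrr mul0r mulr0.
  rewrite [X in _ * X]big_seq [X in _ * X]big1 ?mulr1 // => v.
  rewrite mem_enum => vD.
  by have := nv v; rewrite vD /flipped /= => /negbTE ->; rewrite subr0.
rewrite (sum_prod_avoid (f := fun e a => flip_prob p a (theta e))).
(* Every arc of the star must take one prescribed wrong value, so [v] is flipped with probability
   [(p / (#|gT| - 1)) ^ degree v]. Lowering this to the exponent [d] uses that the base is at most
   1. *)
- rewrite big_enum /= -prodr_const; apply: ler_prod => v vD.
  rewrite (eq_bigr (fun=> p / (#|gT|.-1)%:R)); last first.
    by move=> e ev; rewrite /flip_prob (negbTE (shift_neq _ h1 vD ev)).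
  rewrite prodr_const card_star subr_ge0 exprn_ile1 ?(ltW q0) //= lerD2l lerN2.
  by apply: ler_wiXn2l; rewrite ?(ltW q0).
- by move=> e; exact: flip_prob_sum1.
- exact: enum_uniq.
- by move=> u v; rewrite !mem_enum; exact: disjoint_stars.
Qed.

End FlipProb.

(** * Bound on the recovery probability of one estimator *)

Lemma Pr_mono (R : realType) (T : finType) (mu : fdist R T) (A B : {set T}) :
  A \subset B -> Pr mu A <= Pr mu B.
Proof.
move=> AB; rewrite /Pr [leRHS](big_setID A) /= (finset.setIidPr AB) lerDl.
by apply: sumr_ge0 => t _; exact: Defs.pmf_ge0.
Qed.

Lemma Pr_setC (R : realType) (T : finType) (mu : fdist R T) (A : {set T}) :
  Pr mu A + Pr mu (~: A) = 1.
Proof.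
rewrite -[RHS](Defs.pmf_sum1 mu) /Pr [RHS](bigID (mem A)) /=; congr (_ + _).
by apply: eq_bigl => t; rewrite inE.
Qed.

Lemma recovery_prob_le (R : realType) (gT : finGroupType) (G : digraph) (d : nat)
    (p : R) (Q : observation_kernel R gT G) (D : {set vertex G})
    (T : estimator (SyncProblem Q (uniform_dist R gT))) :
    (2 <= #|gT|)%N -> 0 < p < 1 / 2 -> connected_digraph G ->
    (forall v : vertex G, (degree v <= d)%N) -> is_uniform_kernel p Q ->
    independent D -> (2 <= #|D|)%N ->
  2 * recovery_prob T <= 1 + (1 - (p / (#|gT|.-1)%:R) ^+ d) ^+ #|D|.
Proof.
move=> card_gT p_range Gc degd Qu Di D2.
have [h _ h1] : exists2 h : gT, h \in [set: gT]%SET & h != 1%g.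
  by apply/trivgPn; rewrite -cardG_gt1 cardsT.
set eps := (1 - _) ^+ _.
pose law := sync_law (SyncProblem Q (uniform_dist R gT)).
(* Under the uniform prior all labellings have the same weight [c], so comparing [law] at [x] and at
   its twist is comparing likelihoods. *)
pose c : R := \prod_(v : vertex G) #|gT|%:R^-1.
have c0 : 0 <= c by apply: prodr_ge0 => v _; rewrite invr_ge0.
have lawE x y : law (x, y) = c * \prod_e flip_prob p (y e) (psi x e).
  by rewrite /law /= Qu.
pose S := [set xy | T xy.2 == psi xy.1]%SET.
pose F := [set xy : {ffun vertex G -> gT} * {ffun Defs.arc G -> gT} |
  [exists v in D, flipped D h (psi xy.1) xy.2 v]]%SET.
have total := Pr_setC law S.
have split_S : Pr law S = Pr law (S :&: F) + Pr law (S :\: F).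
  exact: big_setID.
have noF : Pr law (~: F) <= eps.
  have Feps x : \sum_(y | (x, y) \notin F) law (x, y) <= c * eps.
    under eq_bigr do rewrite lawE.
    rewrite -mulr_sumr; apply: ler_wpM2l => //.
    have := no_flip_le card_gT p_range (psi x) Di h1 degd.
    by apply: le_trans; rewrite le_eqVlt; apply/orP; left; apply/eqP;
      apply: eq_bigl => y; rewrite inE.
  have -> : Pr law (~: F) = \sum_x \sum_(y | (x, y) \notin F) law (x, y).
    rewrite /Pr pair_big_dep /=; apply: eq_big => [[x y]|[x y] _] //=.
    by rewrite !inE.
  apply: (@le_trans _ _ (\sum_(x : {ffun vertex G -> gT}) c * eps)).
    by apply: ler_sum => x _.
  rewrite -mulr_suml -[leRHS]mul1r.
  rewrite (_ : \sum_x c = 1) //.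
  exact: Defs.pmf_sum1 (product_dist (fun _ : vertex G => uniform_dist R gT)).
have SF : Pr law (S :&: F) <= Pr law (~: S).
  (* [T y] stands in for [psi x], with which it agrees on [S]. As [vy] depends on [y] only and [phi]
     keeps [y], the twist can be undone, whence injectivity. *)
  pose vy y := [pick v in D | flipped D h (T y) y v].
  pose phi (xy : {ffun vertex G -> gT} * {ffun Defs.arc G -> gT}) :=
    (if vy xy.2 is Some v then twist h v xy.1 else xy.1, xy.2).
  have phi_inj : injective phi.
    move=> [x y] [x' y'] [] /[swap] <-; rewrite /=.
    by case: (vy y) => [v /twist_inj|] ->.
  have phiP xy : xy \in S :&: F -> exists v, [/\ v \in D,
      flipped D h (psi xy.1) xy.2 v & phi xy = (twist h v xy.1, xy.2)].
    case: xy => x y; rewrite !inE /= => /andP[/eqP Ty /existsP[v vF]].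
    rewrite /phi /vy /= Ty; case: pickP => [w /andP[wD wF]|/(_ v)].
      by exists w.
    by rewrite vF.
  have phiS : (phi @: (S :&: F))%SET \subset ~: S.
    apply/fintype.subsetP => _ /imsetP[xy xyS ->].
    have [v [vD _ ->]] := phiP _ xyS.
    move: xyS; rewrite !inE => /andP[/eqP -> _] /=.
    (* A second vertex and connectivity give an arc at [v]. There [psi] changes while [T y] stays,
       so the image is a failure. *)
    have [u /andP[_ uv]] : exists u, (u \in D) && (u != v).
      have : (0 < #|D :\ v|)%N by move: D2; rewrite (cardsD1 v) vD.
      by case/card_gt0P => u; rewrite !inE andbC => uD; exists u.
    have [e ev] := star_neq0 Gc uv.
    apply/eqP => /ffunP/(_ e); rewrite (psi_twist _ _ _ Di) // ev => /esym/eqP.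
    exact/negP/(shift_neq _ h1 vD ev).
  apply: le_trans (Pr_mono law phiS).
  rewrite /Pr big_imset; last exact: in2W.
  apply: ler_sum => xy xyS; have [v [vD vF ->]] := phiP _ xyS.
  case: xy {xyS} vF => x y vF; rewrite !lawE; apply: ler_wpM2l => //.
  exact: likelihood_twist vF.
have SnF : Pr law (S :\: F) <= Pr law (~: F).
  by apply: Pr_mono; rewrite finset.setDE finset.subsetIr.
have -> : recovery_prob T = Pr law S by [].
by move: total split_S noF SF SnF; lra.
Qed.

(** * Decay of the error term and the contradiction for large [n] *)

Lemma exprn_onem_bernoulli (R : realType) (q : R) (m : nat) :
  0 <= q <= 1 -> (1 - q) ^+ m * (1 + m%:R * q) <= 1.
Proof.
case/andP=> q0 q1; have q1' : 0 <= 1 - q by rewrite subr_ge0.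
elim: m => [|m IHm]; first by rewrite mul0r addr0 expr0 mulr1.
(* It remains that [(1 - q) (1 + (m + 1) q) = 1 + m q - (m + 1) q ^ 2] is at most [1 + m q]. *)
apply: le_trans IHm; rewrite exprS mulrAC mulrC ler_wpM2l ?exprn_ge0 //.
have : 0 <= m.+1%:R * q * q by rewrite !mulr_ge0.
by rewrite -natr1; lra.
Qed.

Unset Implicit Arguments.
Set Strict Implicit.
Local Open Scope classical_set_scope.
Local Open Scope ring_scope.

Theorem theorem2 (R : realType) (gT : finGroupType) (d : nat)
    (G : nat -> digraph) (p : nat -> R)
    (Q : forall n, observation_kernel R gT (G n))
    (D : forall n, {set vertex (G n)})
    (card_gT : (2 <= #|gT|)%N)
    (d_ge1 : (1 <= d)%N)
    (G_connected : forall n, connected_digraph (G n))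
    (G_simple : forall n, simple_digraph (G n))
    (G_degree : forall n (v : vertex (G n)), (degree v <= d)%N)
    (Q_uniform : forall n, is_uniform_kernel (p n) (Q n))
    (D_independent : forall n, independent (D n))
    (D_infty : (fun n => #|D n|) @ \oo --> \oo)
    (p_range : forall n, 0 < p n < 1 / 2)
    (p_omega : little_omega p (fun n => (#|D n|%:R : R) `^ (- (1 / d%:R)))) :
  ~ strong_recovery (fun n => SyncProblem (Q n) (uniform_dist R gT)).
Proof.
case=> T T1.
pose k : R := (#|gT|.-1)%:R.
have k1 : 1 <= k by rewrite ler1n -ltnS prednK // ltnW.
have k0 : 0 < k by apply: lt_le_trans k1.
have k20 : 0 < 2 * k by rewrite mulr_gt0.
have [N1 N1p] := p_omega (2 * k) k20.
have [N2 _ N2D] : \forall n \near \oo, (2 <= #|D n|)%N.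
  by apply: (D_infty [set m | (2 <= m)%N]); exists 2.
(* Once [m q ^ d >= 2], the Bernoulli bound gives an error term of at most [1 / (1 + 2)]. Then twice
   the recovery probability is at most [4 / 3], which contradicts this threshold. *)
have [N3 _ N3T] : \forall n \near \oo, 2 / 3 < recovery_prob (T n).
  by apply: (cvgr_gt (1 : R) T1); lra.
pose n := maxn N1 (maxn N2 N3).
have D2 : (2 <= #|D n|)%N by apply: N2D; rewrite /= !leq_max leqnn orbT.
have Tn : 2 / 3 < recovery_prob (T n).
  by apply: N3T; rewrite /= !leq_max leqnn !orbT.
have /andP[_ pn] : 0 <= 2 * k * (#|D n|%:R : R) `^ (- (1 / d%:R)) < p n.
  by apply: N1p; rewrite leq_max leqnn.
have := recovery_prob_le (T n) card_gT (p_range n) (G_connected n)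
  (@G_degree n) (@Q_uniform n) (@D_independent n) D2.
have /andP[q0 qp] := flip_rate_range card_gT (p_range n).
set m := #|D n| in D2 pn *; set q := (_ / _) in q0 qp *.
have m0 : (0 : R) < m%:R by rewrite ltr0n ltnW.
have q1 : q <= 1 by apply: le_trans qp _; case/andP: (p_range n); lra.
(* [p_n > 2 k m ^ (-1/d)] gives [m q ^ d >= 2 ^ d >= 2]. *)
have mq : 2 <= m%:R * q ^+ d.
  pose r : R := m%:R `^ (- (1 / d%:R)).
  have rd : r ^+ d * m%:R = 1.
    rewrite /r -powR_mulrn ?powR_ge0 // -powRrM mulNr mul1r mulVf; last first.
      by rewrite pnatr_eq0 -lt0n.
    by rewrite powR_inv1 ?ltW // mulVf // gt_eqF.
  have rq : 2 * r <= q by rewrite ler_pdivlMr // mulrAC ltW.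
  have r0 : 0 <= 2 * r by rewrite mulr_ge0 // powR_ge0.
  apply: (@le_trans _ _ (m%:R * (2 * r) ^+ d)); last first.
    by rewrite ler_wpM2l ?(ltW m0) // lerXn2r ?nnegrE // ltW.
  rewrite exprMn mulrCA [m%:R * _]mulrC rd mulr1 -[leLHS]expr1.
  by apply: ler_weXn2l; rewrite ?ler1n.
have qd : 0 <= q ^+ d <= 1 by rewrite exprn_ge0 ?exprn_ile1 ?(ltW q0).
have := exprn_onem_bernoulli m qd.
have e0 : 0 <= (1 - q ^+ d) ^+ m by rewrite exprn_ge0 // subr_ge0; case/andP: qd.
have : (1 - q ^+ d) ^+ m * 3 <= (1 - q ^+ d) ^+ m * (1 + m%:R * q ^+ d).
  by rewrite ler_wpM2l //; lra.
by move: Tn; lra.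
Qed.
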